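(* Let $r$ be an integer, let $G$ be a $(P_6+rP_3)$-free graph with no clique of size four, and let $P=(G,L,S)$ be an $r$-seeded precoloring of $G$. Then each connected component of $G|W(P)$ is a clique with at most three vertices.
   Context: Graphs are finite and simple; $P_6+rP_3$ is the disjoint union of a 6-vertex path and $r$ copies of the 3-vertex path; $H$-free means no induced subgraph isomorphic to $H$; $G|A$ is the induced subgraph on $A$. A list assignment is a function $L:V(G)\to 2^{\{1,2,3\}}$; $X^0(L)$ is the set of vertices $v$ with $|L(v)|=1$, and for such $v$ we identify $L(v)$ with its unique element. Standing convention: lists are always updated, i.e. there is no vertex $v$ having a neighbor $u\in X^0(L)$ with $L(u)\subseteq L(v)$. An $r$-seeded precoloring of $G$ is a triple $P=(G,L,S)$ where $L$ is such a list assignment, $S\subseteq V(G)$, $|L(v)|=1$ for every $v\in S$, the map $v\mapsto L(v)$ is a proper coloring of $G|S$, and $G|S$ contains an induced subgraph isomorphic to $P_6+(r-1)P_3$. The boundary $B(P)$ is the set of vertices $v$ with $|L(v)|=2$ having a neighbor $s\in S$ with $L(s)=\{1,2,3\}\setminus L(v)$. The wilderness is $W(P)=V(G)\setminus(X^0(L)\cup B(P))$.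
   Formalization: The formal theorem takes r ≥ 1 (so that P_6+(r−1)P_3 is defined) and additionally assumes that every vertex with a neighbor in S has a nonempty list; with empty lists allowed next to S the claim fails. *)

(* Defs.v *)
From mathcomp Require Import all_boot.

Set Implicit Arguments.
Unset Strict Implicit.
Unset Printing Implicit Defensive.

Record sgraph := SGraph {
  vertex :> finType;
  adj : rel vertex;
  adj_sym : symmetric adj;
  adj_irrefl : irreflexive adj }.

Section Induced.
Variables (G : sgraph) (A : {set G}).
Definition induced_adj : rel {x : G | x \in A} :=
  fun x y => adj (val x) (val y).
Lemma induced_adj_sym : symmetric induced_adj.
Proof. by move=> x y; exact: adj_sym. Qed.
Lemma induced_adj_irrefl : irreflexive induced_adj.
Proof. by move=> x; exact: adj_irrefl. Qed.
Definition induced := SGraph induced_adj_sym induced_adj_irrefl.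
End Induced.

Section PathGraph.
Variable n : nat.
Definition path_adj : rel 'I_n :=
  fun i j => (i.+1 == j :> nat) || (j.+1 == i :> nat).
Lemma path_adj_sym : symmetric path_adj.
Proof. by move=> i j; rewrite /path_adj orbC. Qed.
Lemma path_adj_irrefl : irreflexive path_adj.
Proof. by move=> i; rewrite /path_adj orbb gtn_eqF. Qed.
Definition path_graph := SGraph path_adj_sym path_adj_irrefl.
End PathGraph.

Section DisjointUnion.
Variables G H : sgraph.
Definition dunion_adj : rel (G + H) := fun x y =>
  match x, y with
  | inl a, inl b => adj a b
  | inr a, inr b => adj a b
  | _, _ => false
  end.
Lemma dunion_adj_sym : symmetric dunion_adj.
Proof. by case=> a [] b //=; exact: adj_sym. Qed.
Lemma dunion_adj_irrefl : irreflexive dunion_adj.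
Proof. by case=> a /=; exact: adj_irrefl. Qed.
Definition dunion := SGraph dunion_adj_sym dunion_adj_irrefl.
End DisjointUnion.

Section Copies.
Variables (k : nat) (H : sgraph).
Definition copies_adj : rel ('I_k * H) :=
  fun x y => (x.1 == y.1) && adj x.2 y.2.
Lemma copies_adj_sym : symmetric copies_adj.
Proof. by move=> x y; rewrite /copies_adj eq_sym adj_sym. Qed.
Lemma copies_adj_irrefl : irreflexive copies_adj.
Proof. by move=> x; rewrite /copies_adj adj_irrefl andbF. Qed.
Definition copies := SGraph copies_adj_sym copies_adj_irrefl.
End Copies.

Definition P6_plus_P3s (k : nat) : sgraph :=
  dunion (path_graph 6) (copies k (path_graph 3)).

Definition isomorphic (G H : sgraph) : Prop :=
  exists2 f : G -> H, bijective f & forall x y, adj (f x) (f y) = adj x y.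

Definition has_induced (H G : sgraph) : Prop :=
  exists A : {set G}, isomorphic (induced A) H.

Definition is_free (H G : sgraph) : Prop := ~ has_induced H G.

Definition clique (G : sgraph) (K : {set G}) : bool :=
  [forall x in K, forall y in K, (x != y) ==> adj x y].

Definition components (G : sgraph) : {set {set G}} :=
  equivalence_partition (connect (@adj G)) [set: G].

Definition proper_coloring (G : sgraph) (C : eqType) (c : G -> C) : Prop :=
  forall x y : G, adj x y -> c x != c y.

(* The colours 1, 2, 3 are represented by the three elements of 'I_3. *)
Definition list_assignment (G : sgraph) := G -> {set 'I_3}.

Section Precoloring.
Variable G : sgraph.
Implicit Types (L : list_assignment G) (S : {set G}).

Definition X0 L : {set G} := [set v | #|L v| == 1].

Definition updated L : Prop :=
  forall v u : G, adj v u -> u \in X0 L -> ~~ (L u \subset L v).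

(* On S the lists are singletons, so comparing lists compares colours. Meant
   for r > 0 only, as r - 1 is truncated. *)
Record seeded_precoloring (r : nat) L S : Prop := SeededPrecoloring {
  seeded_updated : updated L;
  seeded_singleton : forall v, v \in S -> #|L v| = 1;
  seeded_proper : @proper_coloring (induced S) _ (fun v => L (val v));
  seeded_contains : has_induced (P6_plus_P3s (r - 1)) (induced S) }.

Definition boundary L S : {set G} :=
  [set v | (#|L v| == 2) && [exists s in S, adj v s && (L s == ~: L v)]].

Definition wilderness L S : {set G} := ~: (X0 L :|: boundary L S).

(* An updated assignment may still have empty lists. A vertex with an empty
   list always lies in the wilderness, even if it has neighbours in S, and
   three such vertices may form an induced P_3 attached to S. This excludes
   empty lists next to S; it holds as soon as no list is empty. *)
Definition nonempty_next_to L S : Prop :=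
  forall v s : G, s \in S -> adj v s -> L v != set0.

End Precoloring.

(* Main.v *)
Require Import Defs.
From mathcomp Require Import all_boot.

Set Implicit Arguments.
Unset Strict Implicit.
Unset Printing Implicit Defensive.

(** A vertex of the wilderness with a neighbour in S would have a list of size
    at most two missing the colour of that neighbour, hence would be precoloured
    or on the boundary. So the wilderness is anticomplete to S, and an induced
    P_3 in it would extend the copy of P_6 + (r-1)P_3 in S to P_6 + rP_3.
    Without induced P_3 the components are cliques. *)

(** Maps, unlike the vertex sets in [has_induced], can be composed with [val] and glued by cases. *)
Definition induced_embedding (H G : sgraph) (f : H -> G) : Prop :=
  injective f /\ forall x y, adj (f x) (f y) = adj x y.

Lemma has_inducedP (H G : sgraph) :
  has_induced H G <-> exists f : H -> G, induced_embedding f.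
Proof.
split=> [[A [f [g fK gK] f_adj]] | [f [f_inj f_adj]]].
  exists (fun x => val (g x)); split; first exact: inj_comp val_inj (can_inj gK).
  by move=> x y; rewrite -[in RHS](gK x) -[in RHS](gK y) f_adj.
(* The map [f] with its codomain cut down to its image; it is bijective by counting, and its inverse
   is the required isomorphism. *)
pose h x : induced (f @: [set: H]) := exist _ (f x) (imset_f f (in_setT x)).
have h_inj : injective h by move=> x y /(congr1 val)/f_inj.
have [|g hK gK] := inj_card_bij h_inj.
  by rewrite card_sig (card_imset _ f_inj) cardsT.
exists (f @: [set: H]), g; first by exists h.
by move=> x y; rewrite -f_adj -[x in RHS]gK -[y in RHS]gK.
Qed.

Lemma has_induced_P6_plus_P3sS (k : nat) (G : sgraph)
    (f : P6_plus_P3s k -> G) (p : path_graph 3 -> G) :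
  induced_embedding f -> induced_embedding p ->
  (forall x i, f x != p i) -> (forall x i, ~~ adj (f x) (p i)) ->
  has_induced (P6_plus_P3s k.+1) G.
Proof.
move=> [f_inj f_adj] [p_inj p_adj] fp_neq fp_nadj; apply/has_inducedP.
(* The new path [p] becomes the copy of index [ord0]; the old copy [j] moves to index
   [lift ord0 j]. *)
pose g (x : P6_plus_P3s k.+1) : G :=
  match x with
  | inl a => f (inl a)
  | inr (i, b) => if unlift ord0 i is Some j then f (inr (j, b)) else p b
  end.
have fpF x i : f x = p i -> False by move/eqP; apply/negP.
have fp_adjF x i : adj (f x) (p i) = false by apply/negbTE.
have pf_adjF x i : adj (p i) (f x) = false by rewrite adj_sym.
exists g; split=> [[a|[i a]] [b|[j b]] /= | [a|[i a]] [b|[j b]] /=].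
- by move/f_inj=> [->].
- by case: unliftP => [j' _ /f_inj|_ /fpF].
- by case: unliftP => [j' _ /f_inj|_ /esym/fpF].
- case: unliftP => [i' ->|->]; case: unliftP => [j' ->|->].
  + by move/f_inj=> [-> ->].
  + by move/fpF.
  + by move/esym/fpF.
  + by move/p_inj=> ->.
- by rewrite f_adj.
- by case: unliftP => [j' _|_]; rewrite ?f_adj ?fp_adjF.
- by case: unliftP => [j' _|_]; rewrite ?f_adj ?pf_adjF.
- rewrite /copies_adj /=.
  case: unliftP => [i' ->|->]; case: unliftP => [j' ->|->].
  + by rewrite f_adj /= /copies_adj /= (inj_eq lift_inj).
  + by rewrite fp_adjF eq_sym (negbTE (neq_lift _ _)).
  + by rewrite pf_adjF (negbTE (neq_lift _ _)).
  + by rewrite p_adj eqxx.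
Qed.

Lemma induced_embedding_P3 (G : sgraph) (a b c : G) :
  adj a b -> adj b c -> a != c -> ~~ adj a c ->
  @induced_embedding (path_graph 3) G (tnth [tuple a; b; c]).
Proof.
move=> ab bc ac nac.
have neq (x y : G) : adj x y -> x != y.
  by move=> xy; apply: contraTneq xy => ->; rewrite adj_irrefl.
split.
  by apply/tuple_uniqP; rewrite /= !inE negb_or ac (neq a b) ?(neq b c).
(* Of the nine pairs of indices, only those in decreasing order survive the rewriting; they need
   symmetry of [adj]. *)
case=> [[|[|[|i]]] //= Hi] [[|[|[|j]]] //= Hj];
  rewrite !(tnth_nth a) /= /path_adj /= ?adj_irrefl ?ab ?bc ?(negbTE nac) //.
- by rewrite adj_sym ab.
- by rewrite adj_sym (negbTE nac).
- by rewrite adj_sym bc.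
Qed.

(** Induction along a walk: if the second vertex is not already [y], it is adjacent to [y] by
    induction, and the closure hypothesis shortcuts it. *)
Lemma P3_free_connect (G : sgraph) (x y : G) :
  (forall a b c : G, adj a b -> adj b c -> a != c -> adj a c) ->
  connect (@adj G) x y -> x != y -> adj x y.
Proof.
move=> P3_closed /connectP[s]; elim: s x => [|z s IHs] x /=.
  by move=> _ ->; rewrite eqxx.
case/andP=> xz zs y_last; have [<- //|zy] := eqVneq z y.
by apply: P3_closed xz _; apply: IHs.
Qed.

(** A subset of a clique is a clique, so any four vertices of a larger clique would form a clique of
    size exactly four. *)
Lemma card_clique_le3 (G : sgraph) (K : {set G}) :
  (forall K' : {set G}, clique K' -> #|K'| <> 4) -> clique K -> #|K| <= 3.
Proof.
move=> noK4 K_clique; rewrite leqNgt; apply/negP => K_gt3.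
have [K' cardK' sK'K] : exists2 K' : {set G}, #|K'| = 4 & K' \subset K.
  have [s [s_uniq s_size sK]] := card_geqP K_gt3.
  exists [set:: s].
    by rewrite cardsE; rewrite -s_size; apply/card_uniqP.
  by apply/subsetP => x; rewrite inE => /sK.
apply: (noK4 K') cardK'; apply/forall_inP => x /(subsetP sK'K) Kx.
apply/forall_inP => y /(subsetP sK'K) Ky.
by move/forall_inP/(_ x Kx)/forall_inP/(_ y Ky): K_clique.
Qed.

Lemma clique_induced (G : sgraph) (A : {set G}) (K : {set induced A}) :
  clique K -> clique (val @: K).
Proof.
move=> /forall_inP K_clique.
apply/forall_inP => _ /imsetP[x Kx ->]; apply/forall_inP => _ /imsetP[y Ky ->].
by rewrite (inj_eq val_inj); move/forall_inP/(_ y Ky): (K_clique x Kx).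
Qed.

Lemma wilderness_anticomplete (r : nat) (G : sgraph) (L : list_assignment G)
    (S : {set G}) (v s : G) :
  seeded_precoloring r L S -> nonempty_next_to L S ->
  v \in wilderness L S -> s \in S -> ~~ adj v s.
Proof.
case=> L_upd L_single _ _ L_nonempty vW sS; apply/negP => vs.
have sX0 : s \in X0 L by rewrite inE L_single.
have Ls_sub := L_upd _ _ vs sX0.
(* As [L s] is a singleton, not being contained in [L v] means being disjoint from it. *)
have Lv_sub : L v \subset ~: L s.
  have /eqP/cards1P[c Ls] := L_single s sS.
  by move: Ls_sub; rewrite Ls sub1set subsetC sub1set inE.
have Ls_compl : #|~: L s| = 2 by rewrite cardsCs setCK card_ord L_single.
have : 0 < #|L v| by rewrite card_gt0 (L_nonempty v s).
have := subset_leq_card Lv_sub; rewrite Ls_compl.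
move: vW; rewrite !inE negb_or => /andP[Lv_neq1 v_nbd] Lv_le2 Lv_gt0.
have Lv2 : #|L v| = 2 by move: Lv_neq1 Lv_le2 Lv_gt0; case: #|L v| => [|[|[|]]].
case/negP: v_nbd; rewrite Lv2 eqxx; apply/exists_inP; exists s => //.
(* [L v] lies in the complement of [L s] and both have two elements, so they coincide: [s] witnesses
   that [v] is on the boundary. *)
rewrite vs -(inj_eq (@setC_inj _)) setCK eq_sym.
by rewrite eqEcard Lv_sub Lv2 Ls_compl.
Qed.

Theorem theorem3p1 (r : nat) (G : sgraph) (L : list_assignment G) (S : {set G})
    (r_gt0 : 0 < r)
    (G_free : is_free (P6_plus_P3s r) G)
    (G_noK4 : forall K : {set G}, clique K -> #|K| <> 4)
    (P_seeded : seeded_precoloring r L S)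
    (L_nonempty : nonempty_next_to L S) :
  forall C : {set induced (wilderness L S)},
    C \in components (induced (wilderness L S)) ->
    clique C /\ #|C| <= 3.
Proof.
have W_anti v s := @wilderness_anticomplete r G L S v s P_seeded L_nonempty.
have S_W s : s \in S -> s \notin wilderness L S.
  by move=> sS; rewrite !inE (seeded_singleton P_seeded) ?eqxx.
set W := wilderness L S in W_anti S_W *.
have P3_closed (a b c : induced W) : adj a b -> adj b c -> a != c -> adj a c.
  move=> ab bc ac; apply: contraT => nac; case: G_free.
  have p_emb := @induced_embedding_P3 (induced W) a b c ab bc ac nac.
  have /has_inducedP[f [f_inj f_adj]] := seeded_contains P_seeded.
  (* Positivity of [r] makes the truncated [r - 1] a true predecessor [k], so that one more path
     gives [r] copies. *)
  case: r r_gt0 {P_seeded} f f_inj f_adj => // k _.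
  rewrite subSS subn0 => f f_inj f_adj.
  apply: (@has_induced_P6_plus_P3sS k G (fun x => val (f x))
            (fun i => val (tnth [tuple a; b; c] i))).
  - by split=> //; apply: inj_comp val_inj f_inj.
  - by case: p_emb => p_inj p_adj; split=> //; apply: inj_comp val_inj p_inj.
  - move=> x i; apply: contraTneq (valP (tnth [tuple a; b; c] i)) => <-.
    exact: S_W (valP (f x)).
  - by move=> x i; rewrite adj_sym; apply: W_anti; apply: valP.
move=> C /imsetP[x _ C_def].
have C_clique : clique C.
  apply/forall_inP => y Cy; apply/forall_inP => z Cz; apply/implyP.
  apply: P3_free_connect P3_closed _.
  (* [C] is the connectivity class of [x], so [y] and [z] are joined through [x]. *)
  move: Cy Cz; rewrite C_def !inE /= => xy xz.
  have conn_sym : connect_sym (@adj (induced W)).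
    by apply: sym_connect_sym; apply: adj_sym.
  by rewrite conn_sym in xy; apply: connect_trans xy xz.
(* The bound on cliques concerns [G], so [C] is counted through its image there. *)
split=> //; rewrite -(card_imset _ val_inj).
exact: card_clique_le3 G_noK4 (clique_induced C_clique).
Qed.
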